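(* Suppose that $\kappa < \mu$ are infinite cardinals such that $\mathrm{cf}(\mu) < \kappa$ and there does not exist a strongly unbounded subadditive coloring $c:(\mathscr{P}_\kappa \mu^+)^{[2]} \rightarrow \mathrm{cf}(\mu)$. Then $\mathsf{CP}(\mathcal D)$ holds for every uniform, transitive $\mathrm{cf}(\mu)$-covering matrix $\mathcal D$ for $\mu^+$.
   Context: $\mathscr{P}_\kappa X = \{x \subseteq X \mid |x|<\kappa\}$, viewed as a partial order under $\subsetneq$; $(\mathscr{P}_\kappa X)^{[2]}$ is the set of pairs $(x,y)$ of elements of $\mathscr{P}_\kappa X$ with $x \subsetneq y$. For a partial order $\Lambda$ and $\Lambda^{[2]}$ its set of pairs $(u,v)$ with $u<_\Lambda v$, a function $c:\Lambda^{[2]} \to \theta$ is subadditive if for all $u <_\Lambda v <_\Lambda w$: $c(u,w) \leq \max\{c(u,v), c(v,w)\}$ and $c(u,v) \leq \max\{c(u,w), c(v,w)\}$; strongly unbounded if for every cofinal $\Gamma \subseteq \Lambda$, $c``\Gamma^{[2]}$ is unbounded in $\theta$. For regular cardinals $\theta < \lambda$, a $\theta$-covering matrix for $\lambda$ is $\mathcal D = \langle D(i,\beta) \mid i < \theta, \beta < \lambda\rangle$ such that (1) for each $\beta<\lambda$, $\langle D(i,\beta) \mid i < \theta\rangle$ is $\subseteq$-increasing with union $\beta$; (2) for all $\beta < \gamma < \lambda$ and $i < \theta$ there is $j < \theta$ with $D(i,\beta) \subseteq D(j,\gamma)$. $\mathcal D$ is transitive if for all $\beta < \gamma<\lambda$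 and $i<\theta$, $\beta \in D(i,\gamma)$ implies $D(i,\beta) \subseteq D(i,\gamma)$; uniform if for every limit $\beta < \lambda$ there is $i<\theta$ such that $D(i,\beta)$ contains a club in $\beta$. $\mathsf{CP}(\mathcal D)$ holds if there is an unbounded $A \subseteq \lambda$ such that for every $X \in [A]^\theta$ there are $\beta<\lambda$ and $i<\theta$ with $X \subseteq D(i,\beta)$. *)

(* Defs.v *)
From HB Require Import structures.
From mathcomp Require Import all_boot all_order.
From mathcomp Require Import boolp classical_sets functions cardinality.

Set Implicit Arguments.
Unset Strict Implicit.
Unset Printing Implicit Defensive.

Import Order.TTheory.
Local Open Scope classical_set_scope.
Local Open Scope order_scope.
Local Open Scope card_scope.

Reserved Notation "A '#<' B" (at level 79, format "A  '#<'  B").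

Definition card_lt T U (A : set T) (B : set U) : bool :=
  (A #<= B) && ~~ (A #= B).
Notation "A '#<' B" := (card_lt A B) : card_scope.

(* In a limit ordinal, being cofinal is the same as being unbounded. *)
Definition cofinal d (P : porderType d) (A : set P) : Prop :=
  forall x, exists2 y, A y & x <= y.

(* An ordinal is represented by a well-ordered type: its elements are the
   smaller ordinals, and the element b is, as a set, [set a | a < b]. *)
Definition is_ordinal d (T : orderType d) : Prop :=
  well_founded (fun x y : T => x < y).

(* Cardinals are initial ordinals. *)
Definition is_cardinal d (T : orderType d) : Prop :=
  is_ordinal T /\ forall b : T, [set a | a < b] #< [set: T].

Definition is_infinite_cardinal d (T : orderType d) : Prop :=
  is_cardinal T /\ infinite_set [set: T].

(* L = M^+ *)
Definition is_successor_cardinal dL (L : orderType dL) dM (M : orderType dM) :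
    Prop :=
  [/\ is_cardinal L, [set: M] #< [set: L] &
      forall (U : Type) (B : set U), [set: M] #< B -> [set: L] #<= B].

(* T = cf(M), the least cardinality of a cofinal subset of M *)
Definition is_cofinality dT (T : orderType dT) dM (M : orderType dM) : Prop :=
  [/\ is_cardinal T,
      exists2 A : set M, cofinal A & A #= [set: T] &
      forall A : set M, cofinal A -> [set: T] #<= A].

Section Colorings.
Context d (P : porderType d) dT (T : orderType dT).

Definition pairs : Type := {p : P * P | p.1 < p.2}.

Definition mkpair (u v : P) (uv : u < v) : pairs := exist _ (u, v) uv.

Definition subadditive (c : pairs -> T) : Prop :=
  forall (u v w : P) (uv : u < v) (vw : v < w) (uw : u < w),
    c (mkpair uw) <= Order.max (c (mkpair uv)) (c (mkpair vw)) /\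
    c (mkpair uv) <= Order.max (c (mkpair uw)) (c (mkpair vw)).

Definition strongly_unbounded (c : pairs -> T) : Prop :=
  forall G : set P, cofinal G ->
    cofinal (c @` [set p | G (val p).1 /\ G (val p).2]).

End Colorings.

(* The order is inherited from set X, hence < is strict inclusion, see
   lt_PkappaE. *)
Definition Pkappa (K X : Type) : Type :=
  {x : set X | x \in [set y : set X | y #< [set: K]]}.

HB.instance Definition _ (K X : Type) := SubChoice.on (Pkappa K X).
HB.instance Definition _ (K X : Type) :=
  [SubChoice_isSubPOrder of Pkappa K X by <: with set_display].

Lemma lt_PkappaE (K X : Type) (x y : Pkappa K X) :
  (x < y) = (val x `<` val y) :> Prop.
Proof. by rewrite -properEset. Qed.

Section Clubs.
Context d (L : orderType d).

Definition is_limit (b : L) : Prop :=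
  (exists a, a < b) /\ forall a, a < b -> exists2 g, a < g & g < b.

Definition unbounded_below (C : set L) (b : L) : Prop :=
  forall a, a < b -> exists2 g, C g & a <= g /\ g < b.

Definition club_in (C : set L) (b : L) : Prop :=
  [/\ C `<=` [set a | a < b],
      unbounded_below C b &
      forall a, a < b -> is_limit a -> unbounded_below C a -> C a].

End Clubs.

Section CoveringMatrices.
Context dT (T : orderType dT) dL (L : orderType dL).
Implicit Type D : T -> L -> set L.

Definition covering_matrix D : Prop :=
  [/\ forall b i j, i <= j -> D i b `<=` D j b,
      forall b, \bigcup_i D i b = [set a | a < b] &
      forall b g i, b < g -> exists j, D i b `<=` D j g].

Definition transitive_matrix D : Prop :=
  forall b g i, b < g -> D i g b -> D i b `<=` D i g.

Definition uniform_matrix D : Prop :=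
  forall b, is_limit b ->
    exists i, exists2 C : set L, club_in C b & C `<=` D i b.

Definition CP D : Prop :=
  exists2 A : set L, cofinal A &
    forall X : set L, X `<=` A -> X #= [set: T] ->
      exists b i, X `<=` D i b.

End CoveringMatrices.

(* Main.v *)
Require Import Defs.
From HB Require Import structures.
From mathcomp Require Import all_boot all_order.
From mathcomp Require Import boolp classical_sets functions cardinality.

(**
  Write F_b(j) = D(j, b) `&` x for x in P_kappa(mu^+). By transitivity F_b is
  included in F_g for b < g at all large j. If for every x this sequence
  stabilizes modulo bounded, say from b_x on, then the least i such that F_{b_x}
  and F_{b_y} agree on x at all j >= i is a subadditive coloring c(x, y); a
  cofinal family on which c is bounded glues the functions
  a |-> min {j | a \in D(j, b_x)} into one function mu^+ -> cf(mu), and an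
  unbounded set on which this function is bounded witnesses CP(D).

  Stabilization is an argument of Shelah, with uniformity as its key input.
  Since mu is a limit cardinal, N = kappa^+, I = kappa^{++} and R = kappa^{+3}
  lie below mu. If some sequence of traces did not stabilize, build a strictly
  growing R-sequence of traces that, for every initial segment of every member
  of a club-guessing family of N-sequences in R, anticipates an upper bound
  whenever one exists. At the supremum a club lies in a single D(i, b), so a
  guessed N-sequence inside that club consists of traces increasing up to fixed
  bounds; its unions have to stop growing because N is larger than x and cf(mu),
  a contradiction.
*)

Set Implicit Arguments.
Unset Strict Implicit.
Unset Printing Implicit Defensive.

Import Order.TTheory.
Local Open Scope order_scope.
Local Open Scope classical_set_scope.
Local Open Scope card_scope.

(** * Recursion on well-founded relations and comparison of cardinals *)

Lemma ordinal_least d (W : orderType d) (wfW : is_ordinal W) (A : set W) :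
  A !=set0 -> exists2 m, A m & forall a, A a -> m <= a.
Proof.
move=> [a Aa]; move: a Aa.
apply: (well_founded_ind wfW) => a IH Aa.
have [[b [ba Ab]]|nb] := pselect (exists b, b < a /\ A b); first exact: IH Ab.
by exists a => // b Ab; rewrite leNgt; apply/negP => ba; apply: nb; exists b.
Qed.

(** [Fix] supplies a function on predecessors only, which [ext] completes with the default [v0];
    locality of [P] transfers the condition between this completion and [f]. *)
Lemma wf_choice_recursion (I V : Type) (v0 : V) (R : I -> I -> Prop)
    (P : I -> (I -> V) -> V -> Prop) :
  well_founded R ->
  (forall s f g v, (forall t, R t s -> f t = g t) -> P s f v -> P s g v) ->
  (forall s f, (forall t, R t s -> P t f (f t)) -> exists v, P s f v) ->
  exists f, forall s, P s f (f s).
Proof.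
move=> wfR locP exP.
pose ext s (g : forall t, R t s -> V) t :=
  if pselect (R t s) is left h then g t h else v0.
have /choice[ch chP] : forall sf : I * (I -> V),
    exists v, (exists w, P sf.1 sf.2 w) -> P sf.1 sf.2 v.
  move=> [s f]; have [[v Pv]|nv] := pselect (exists w, P s f w);
    by [exists v|exists v0].
pose step s g := ch (s, ext s g).
pose f := Fix wfR (fun _ => V) step.
have fE s : f s = step s (fun t _ => f t).
  rewrite /f Fix_eq // => t g h gh; congr step.
  by apply: functional_extensionality_dep => u;
     apply: functional_extensionality_dep => hu.
exists f => s; elim/(well_founded_ind wfR): s => s IH.
have extE t : R t s -> f t = ext s (fun t _ => f t) t.
  by rewrite /ext; case: pselect.
have [v Pv] := exP s f IH.
apply: (locP _ (ext s (fun t _ => f t))); first by move=> t /extE.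
rewrite fE /step; apply: (chP (s, _)).
by exists v; apply: locP Pv => t; apply: extE.
Qed.

Lemma card_leI T U (A : set T) (B : set U) (f : T -> U) :
  (forall a, A a -> B (f a)) ->
  (forall a b, A a -> A b -> f a = f b -> a = b) -> A #<= B.
Proof.
move=> AB fI.
suff [g] : $|{injfun A >-> B}| by exact: inj_card_le.
apply/injfunPex; exists f => // a b; rewrite !inE => Aa Ab; exact: fI.
Qed.

Lemma card_leE T U (A : set T) (B : set U) (u : U) : A #<= B ->
  exists f : T -> U, (forall a, A a -> B (f a)) /\
    (forall a b, A a -> A b -> f a = f b -> a = b).
Proof.
move=> /card_leP[f].
pose g a := if pselect (A a) is left h then
   val (f (SigSub (mem_set h) : A)) else u.
exists g; split=> [a Aa|a b Aa Ab]; rewrite /g.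
  by case: pselect => // h; have := valP (f (SigSub (mem_set h))); rewrite inE.
case: pselect => // ha; case: pselect => // hb /val_inj.
move=> /(@inj _ _ _ f) => /(_ (mem_set I) (mem_set I)) [].
by [].
Qed.

Lemma card_ltNge T U (A : set T) (B : set U) : A #< B -> ~ (B #<= A).
Proof. by move=> /andP[AB /negP AnB] BA; apply: AnB; rewrite card_eq_le AB BA. Qed.

Lemma card_lt_le T U (A : set T) (B : set U) : A #< B -> A #<= B.
Proof. by case/andP. Qed.

Lemma card_ltI T U (A : set T) (B : set U) : A #<= B -> ~ (B #<= A) -> A #< B.
Proof.
by move=> AB BnA; rewrite /card_lt AB /=; apply/negP; rewrite card_eq_le => /andP[].
Qed.

(** An injection into [B] is built along [R]: if no fresh value were left at [b], choosing preimages
    would embed [B] into the predecessors of [b]. A general [R] allows the ordering of pairs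
    below. *)
Lemma card_le_small_segments T (R : T -> T -> Prop) (S : set T) U (B : set U) :
  well_founded R ->
  (forall a b, S a -> S b -> a <> b -> R a b \/ R b a) ->
  (forall b, S b -> ~ (B #<= [set a | S a /\ R a b])) ->
  S #<= B.
Proof.
move=> wfR totR small.
have [[s0 Ss0]|S0] := pselect (S !=set0); last first.
  suff -> : S = set0 by [].
  by apply/seteqP; split=> // a Sa; case: S0; exists a.
have [u Bu] : B !=set0.
  apply: contrapT => B0; apply: (small s0 Ss0).
  suff -> : B = set0 by [].
  by apply/seteqP; split=> // a Ba; case: B0; exists a.
have [f fP] : exists f, forall s, S s -> B (f s) /\
    forall t, S t -> R t s -> f t <> f s.
  apply: (@wf_choice_recursion T U u R (fun s f v => S s -> B v /\
    forall t, S t -> R t s -> f t <> v)) => // [s f g v fg H Ss|s f _].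
    have [Bv Hv] := H Ss; split=> // t St ts; rewrite -fg //; exact: Hv.
  have [Ss|nSs] := pselect (S s); last by exists u.
  apply: contrapT => none.
  have cov v : B v -> exists t, [/\ S t, R t s & f t = v].
    move=> Bv; apply: contrapT => nt; apply: none; exists v => _; split=> // t St ts ft.
    by apply: nt; exists t.
  apply: (small s Ss).
  have /choice[h hP] : forall v, exists t, B v -> [/\ S t, R t s & f t = v].
    move=> v; have [/cov[t tP]|nB] := pselect (B v); first by exists t.
    by exists s0.
  apply: (card_leI (f := h)) => [v /hP[] //|v w /hP[_ _ fv] /hP[_ _ fw] vw].
  by rewrite -fv vw.
apply: (card_leI (f := f)) => [a /fP[] //|a b Sa Sb fab].
apply: contrapT => /(totR _ _ Sa Sb) [ab|ba].
  by have [_ /(_ a Sa ab)] := fP b Sb.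
by have [_ /(_ b Sb ba)] := fP a Sa; rewrite fab.
Qed.

Lemma ordinal_card_total d (W : orderType d) (wfW : is_ordinal W) (S : set W)
  U (B : set U) : ~ (B #<= S) -> S #<= B.
Proof.
move=> BS; apply: (card_le_small_segments wfW) => [a b _ _ /eqP|b Sb BSb].
  by rewrite neq_lt => /orP[]; [left|right].
by apply: BS; apply: card_le_trans BSb _; apply: subset_card_le => a [].
Qed.

(** * Squares of infinite ordinals and regularity *)

Lemma card_setX_le T1 T2 U1 U2 (A1 : set T1) (A2 : set T2) (B1 : set U1)
    (B2 : set U2) : A1 #<= B1 -> A2 #<= B2 -> A1 `*` A2 #<= B1 `*` B2.
Proof.
move=> le1 le2.
have [[[a1 a2] [Aa1 Aa2]]|A0] := pselect (A1 `*` A2 !=set0); last first.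
  suff -> : A1 `*` A2 = set0 by [].
  by apply/seteqP; split=> // a Sa; case: A0; exists a.
have ne T U (A : set T) (B : set U) a : A #<= B -> A a -> exists u : U, True.
  by move=> /card_leP[f] Aa; exists (val (f (SigSub (mem_set Aa)))).
have [u1 _] := ne _ _ _ _ _ le1 Aa1.
have [u2 _] := ne _ _ _ _ _ le2 Aa2.
have [f1 [f1B f1I]] := card_leE u1 le1.
have [f2 [f2B f2I]] := card_leE u2 le2.
apply: (card_leI (f := fun p => (f1 p.1, f2 p.2))) => [[x y] [/= Ax Ay]|].
  by split; [exact: f1B|exact: f2B].
move=> [x y] [x' y'] [/= Ax Ay] [/= Ax' Ay'] [/f1I e1 /f2I e2].
by rewrite e1 // e2.
Qed.

Lemma infinite_two T (A : set T) : infinite_set A ->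
  exists a b, [/\ A a, A b & a <> b].
Proof.
move=> Ainf.
have [a Aa] := infinite_setN0 Ainf.
have /infinite_setN0[b [Ab nb]] : infinite_set (A `\` [set a]).
  by apply: infinite_setD => //; exact: finite_set1.
by exists a, b; split=> // ab; apply: nb.
Qed.

Lemma card_setU_le T U V (A B : set T) (C : set U) (X : set V):
  infinite_set X -> X `*` C #<= X -> A #<= C -> B #<= C -> A `|` B #<= X.
Proof.
move=> /infinite_two[x0 [x1 [Xx0 Xx1 x01]]] XC AC BC.
apply: card_le_trans XC.
have [[c _]|C0] := pselect (exists u : U, True); last first.
  suff -> : A `|` B = set0 by [].
  apply/seteqP; split=> // a [Aa|Ba]; apply: C0.
    by move/card_leP: AC => [f]; exists (val (f (SigSub (mem_set Aa)))).
  by move/card_leP: BC => [f]; exists (val (f (SigSub (mem_set Ba)))).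
have [f [fC fI]] := card_leE c AC.
have [g [gC gI]] := card_leE c BC.
pose h a := if pselect (A a) then (x0, f a) else (x1, g a).
apply: (card_leI (f := h)) => [a|a b]; rewrite /h.
  by case: pselect => [Aa _|nA [//|Ba]]; split=> //=; [apply: fC|apply: gC].
case: pselect => [Aa _|nAa [//|Ba]]; case: pselect => [Ab _|nAb [//|Bb]] [] //.
- exact: fI.
- by move=> /esym.
- exact: gI.
Qed.

Section Goedel.
Context d (W : orderType d).

(** Goedel's canonical ordering of pairs; comparing maxima first confines the predecessors of a pair
    to the square of a closed segment. *)
Definition goedel_lt (p q : W * W) : Prop :=
  let m (r : W * W) := Order.max r.1 r.2 in
  m p < m q \/ m p = m q /\ (p.1 < q.1 \/ p.1 = q.1 /\ p.2 < q.2).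

Lemma goedel_wf : is_ordinal W -> well_founded goedel_lt.
Proof.
move=> wfW [a b]; move: {2}(Order.max _ _) (erefl (Order.max a b)) => m.
elim/(well_founded_ind wfW): m a b => m IHm a.
elim/(well_founded_ind wfW): a => a IHa b.
elim/(well_founded_ind wfW): b => b IHb mE.
constructor=> -[a' b'] [/= lt|[/= e [lt|[ae lt]]]].
- by apply: (IHm (Order.max a' b')) => //; rewrite -mE.
- by apply: IHa => //; rewrite e.
- by subst a'; apply: IHb => //; rewrite e.
Qed.

Lemma goedel_total p q : p <> q -> goedel_lt p q \/ goedel_lt q p.
Proof.
case: p q => [a b] [a' b'] ne; rewrite /goedel_lt /=.
case: (ltgtP (Order.max a b) (Order.max a' b')) => [||e];
  [by left; left|by right; left|].
case: (ltgtP a a') => [lt|lt|ae]; [by left; right; split=> //; left| |].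
  by right; right; split=> //; left.
case: (ltgtP b b') => [lt|lt|be].
- by left; right; split=> //; right.
- by right; right; split=> //; right.
- by case: ne; rewrite ae be.
Qed.

End Goedel.

(** If [S] embeds in the segment below one of its points, the hypothesis at that point suffices.
    Otherwise [S] acts as a cardinal, and the squares containing the Goedel segments are too small
    for [S] to embed in them. *)
Lemma ordinal_square_segment d (W : orderType d) (wfW : is_ordinal W)
    (S : set W) :
  (forall a b, S b -> a < b -> S a) ->
  (forall a, S a -> infinite_set [set b | b < a] ->
     [set b | b < a] `*` [set b | b < a] #<= [set b | b < a]) ->
  infinite_set S -> S `*` S #<= S.
Proof.
move=> downS sq Sinf.
have [[a [Sa Sa_le]]|initS] := pselect (exists a, S a /\ S #<= [set b | b < a]).
  have ainf : infinite_set [set b | b < a].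
    by move=> fin; apply: Sinf; apply: card_le_finite Sa_le fin.
  apply: card_le_trans (card_setX_le Sa_le Sa_le) _.
  apply: card_le_trans (sq a Sa ainf) _.
  by apply: subset_card_le => b /= ba; apply: downS Sa ba.
apply: (card_le_small_segments (goedel_wf wfW)) => [p q _ _|[p q] [/= Sp Sq]].
  exact: goedel_total.
set m := Order.max p q => Sle.
have Sm : S m by rewrite /m; case: (leP p q).
pose M := [set b | b <= m].
have {}Sle : S #<= M `*` M.
  apply: card_le_trans Sle _; apply: subset_card_le => -[a b] [_ lt] /=.
  have : Order.max a b <= m by case: lt => /= [/ltW|[-> _]].
  by rewrite ge_max => /andP[].
have [fin|inf] := pselect (finite_set [set b | b < m]).
  apply: Sinf; apply: card_le_finite Sle _.
  have Mfin : finite_set M.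
    apply: (@sub_finite_set _ _ ([set b | b < m] `|` [set m])).
      by move=> b; rewrite /M /= le_eqVlt => /orP[/eqP|]; [right|left].
    by rewrite finite_setU; split=> //; exact: finite_set1.
  exact: finite_setX.
apply: initS; exists m; split=> //.
apply: card_le_trans Sle _.
have sqm := sq m Sm inf.
have Mle : M #<= [set b | b < m].
  have -> : M = [set b | b < m] `|` [set m].
    apply/seteqP; split=> b; rewrite /M /=.
      by rewrite le_eqVlt => /orP[/eqP|]; [right|left].
    by move=> [/ltW|->].
  apply: (card_setU_le inf sqm); first exact: card_lexx.
  have [b [_ [bm _ _]]] := infinite_two inf.
  by apply: (card_leI (f := fun=> b)) => // x y /= -> ->.
exact: card_le_trans (card_setX_le Mle Mle) sqm.
Qed.

Lemma ordinal_square_lt d (W : orderType d) (wfW : is_ordinal W) (a : W) :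
  infinite_set [set b | b < a] ->
  [set b | b < a] `*` [set b | b < a] #<= [set b | b < a].
Proof.
elim/(well_founded_ind wfW): a => a IH.
apply: (ordinal_square_segment wfW) => [b c /= ca bc|b ba]; first exact: lt_trans ca.
exact: IH.
Qed.

Lemma ordinal_square d (W : orderType d) (wfW : is_ordinal W) :
  infinite_set [set: W] -> [set: W] `*` [set: W] #<= [set: W].
Proof.
by apply: (ordinal_square_segment wfW) => // a _; exact: ordinal_square_lt.
Qed.

(** A way to say that the cofinality of [W] exceeds the size of [A] without naming that
    cofinality. *)
Definition bounded_families X (A : set X) d (W : orderType d) : Prop :=
  forall f : X -> W, exists w, forall x, A x -> f x < w.

(** Regularity of successor cardinals: an unbounded family would cover [W] by at most |[B]| segments
    of size at most |[B]|. *)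
Lemma regular_bounded_families X (A : set X) d (W : orderType d) U (B : set U) :
  infinite_set B -> B `*` B #<= B ->
  (forall w : W, [set a | a < w] #<= B) -> ~ ([set: W] #<= B) ->
  A #<= B -> bounded_families A W.
Proof.
move=> Binf sqB segB WB AB f.
have [u [_ [Bu _ _]]] := infinite_two Binf.
have nomax (w : W) : exists v, w < v.
  apply: contrapT => nv; apply: WB.
  have -> : [set: W] = [set a | a < w] `|` [set w].
    apply/seteqP; split=> // a _ /=.
    by case: (ltgtP a w) => [|wa|]; [left| |right] => //; case: nv; exists a.
  apply: (card_setU_le Binf sqB) => //.
  by apply: (card_leI (f := fun=> u)) => // x y /= -> ->.
apply: contrapT => unb.
have /choice[h hP] : forall w, exists x, A x /\ w < f x.
  move=> w; have [v wv] := nomax w.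
  apply: contrapT => nx; apply: unb; exists v => x Ax.
  rewrite ltNge; apply/negP => vx; apply: nx; exists x; split=> //.
  exact: lt_le_trans vx.
have /choice[e eP] : forall w : W, exists e : W -> U,
  (forall a, a < w -> B (e a)) /\ (forall a b, a < w -> b < w -> e a = e b -> a = b).
  by move=> w; exact: (card_leE u (segB w)).
have [g [gB gI]] := card_leE u AB.
apply: WB; apply: card_le_trans sqB.
(* A point [w] is coded by an index whose value exceeds [w] and by its place in the segment below
   that value. *)
apply: (card_leI (f := fun w => (g (h w), e (f (h w)) w))) => [w _|v w _ _ [/gI]].
  have [Ah wf] := hP w; have [eB _] := eP (f (h w)).
  by split=> /=; [exact: gB|exact: eB].
have [Av vf] := hP v; have [Aw wf] := hP w.
move=> /(_ Av Aw) hE; rewrite -hE => /(proj2 (eP _)); apply=> //.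
by rewrite hE.
Qed.

(** * Club guessing *)

Definition is_strict_sup d (W : orderType d) (A : set W) (s : W) : Prop :=
  (forall a, A a -> a < s) /\ (forall v, v < s -> exists2 a, A a & v <= a).

Lemma strict_sup_exists d (W : orderType d) (wfW : is_ordinal W) (A : set W) :
  (exists w, forall a, A a -> a < w) -> exists s, is_strict_sup A s.
Proof.
move=> /(ordinal_least wfW)[s sA sle]; exists s; split=> // v vs.
apply: contrapT => nv; move: vs; rewrite ltNge => /negP; apply; apply: sle => a Aa.
by rewrite ltNge; apply/negP => va; apply: nv; exists a.
Qed.

Section ClubGuessing.
Context d (W : orderType d).

Definition closure_points (g : W -> W) : set W :=
  [set s | forall t, t < s -> g t < s].

(** The supremum of the iterates of a function dominating [g] on closed segments is a closure
    point. *)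
Lemma closure_points_unbounded (wfW : is_ordinal W) (g : W -> W) :
  bounded_families [set: nat] W ->
  (forall u : W, bounded_families [set t | t <= u] W) ->
  forall s0, exists2 s, s0 < s & closure_points g s.
Proof.
move=> bnat bseg s0.
have /choice[h hP] : forall u : W, exists v, forall t, t <= u -> g t < v.
  by move=> u; exact: (bseg u g).
pose u n := iter n h s0.
have [s [us sle]] : exists s, is_strict_sup (u @` setT) s.
  apply: strict_sup_exists => //; have [w wP] := bnat u.
  by exists w => _ [n _ <-]; exact: wP.
exists s; first by apply: us; exists 0%N.
move=> t /sle[_ [n _ <-] /hP tn]; apply: lt_trans tn _.
by apply: us; exists n.+1.
Qed.

(* Closure points form a closed set containing the least element. *)
Lemma last_closure_point (wfW : is_ordinal W) I (J : set I) (g : I -> W -> W) w :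
  let E := [set s | forall i, J i -> closure_points (g i) s] in
  exists p, [/\ E p, p <= w & forall e, E e -> e <= w -> e <= p].
Proof.
move=> E.
have [p pub ple] := ordinal_least wfW (A := [set p | forall e, E e -> e <= w -> e <= p])
  (ex_intro _ w (fun e _ => id)).
exists p; split=> //; last by apply: ple => e.
move=> i Ji t tp.
have [e [Ee ew te]] : exists e, [/\ E e, e <= w & t < e].
  apply: contrapT => ne; move: tp; rewrite ltNge => /negP; apply; apply: ple => e Ee ew.
  by rewrite leNgt; apply/negP => te; apply: ne; exists e.
exact: lt_le_trans (Ee i Ji t te) (pub e Ee ew).
Qed.

Context dN (N : orderType dN).

(** Monotonicity is not strict because the candidates below, last closure points, may repeat; the
    third clause keeps them from becoming constant. *)
Definition guesses (c : N -> W) (g : W -> W) : Prop :=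
  [/\ forall n m, n <= m -> c n <= c m,
      forall n, closure_points g (c n) &
      forall n, exists m, c n < c m].

Definition cofinal_in (a : N -> W) (w : W) : Prop :=
  [/\ forall n m, n <= m -> a n <= a m, forall n, a n < w &
      forall t, t < w -> exists n, t <= a n].

(* Shelah's club guessing: were every candidate refuted, then for a suitable w
   each value [last (E i) (a w n)] decreases with [i], hence is eventually
   constant, and a candidate taken after all of them have stabilized lies in
   the club meant to refute it. *)
Lemma club_guessing dI (I : orderType dI) (w0 : W) (i0 : I) (n0 : N) :
  is_ordinal W -> is_ordinal N -> is_ordinal I ->
  (forall n : N, exists m, n < m) ->
  bounded_families [set: nat] W ->
  (forall u : W, bounded_families [set t | t <= u] W) ->
  bounded_families [set: N] W -> bounded_families [set: I] W ->
  bounded_families [set: N] I ->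
  exists c : W -> I -> N -> W, forall g, exists w i, guesses (c w i) g.
Proof.
move=> wfW wfN wfI nomaxN bnat bseg bN bI bNI.
have /choice[a aP] : forall w, exists a : N -> W,
    (exists a', cofinal_in a' w) -> cofinal_in a w.
  move=> w; have [[a' a'P]|na] := pselect (exists a', cofinal_in a' w).
    by exists a'.
  by exists (fun=> w0).
pose is_last (E : set W) (w p : W) :=
  [/\ E p, p <= w & forall e, E e -> e <= w -> e <= p].
have /choice[last lastP] : forall Ew : set W * W,
    exists p, (exists q, is_last Ew.1 Ew.2 q) -> is_last Ew.1 Ew.2 p.
  move=> Ew; have [[q qP]|nq] := pselect (exists q, is_last Ew.1 Ew.2 q).
    by exists q.
  by exists w0.
pose E (g : I -> W -> W) i :=
  [set s | forall k, k < i -> closure_points (g k) s].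
have EP g i w : is_last (E g i) w (last (E g i, w)).
  exact/(lastP (_, _))/(last_closure_point wfW [set k | k < i]).
pose cand g i w n := last (E g i, a w n).
(* If some function refutes all candidates of stage [i], then [g i] does; these candidates depend
   only on [g k] for [k < i]. *)
have [g gP] : exists g, forall i,
    (exists h, forall w, ~ guesses (cand g i w) h) ->
    forall w, ~ guesses (cand g i w) (g i).
  apply: (@wf_choice_recursion I (W -> W) id (fun k i => k < i)
    (fun i g h' => (exists h, forall w, ~ guesses (cand g i w) h) ->
      forall w, ~ guesses (cand g i w) h')) => // [i g g' h gg'|i g _].
    suff EE : E g i = E g' i by rewrite /cand EE.
    by apply/seteqP; split=> s Es k ki; have := Es k ki; rewrite gg'.
  have [[h hP]|nh] := pselect (exists h, forall w, ~ guesses (cand g i w) h).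
    by exists h.
  by exists id.
exists (fun w i => cand g i w) => h; apply: contrapT => none.
have {none gP}gP i w : ~ guesses (cand g i w) (g i).
  by apply: gP; exists h => {}w gw; apply: none; exists w, i.
pose EI := [set s | forall i, closure_points (g i) s].
(* One function [b] dominates every [g i], so its closure points are common to all of them. *)
have EIunb w : exists2 s, w < s & EI s.
  have /choice[b bP] : forall t, exists b, forall i, g i t < b.
    by move=> t; have [b bP] := bI (g ^~ t); exists b => i; exact: bP.
  have [s ws sP] := closure_points_unbounded wfW b bnat bseg w.
  by exists s => // i t ts; apply: lt_trans (bP t i) (sP t ts).
have [e eP] : exists e : N -> W, forall n,
    EI (e n) /\ forall m, m < n -> e m < e n.
  apply: (@wf_choice_recursion N W w0 (fun m n => m < n)
    (fun n e v => EI v /\ forall m, m < n -> e m < v)) => // [n e e' v ee' [Ev ev]|n e _].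
    by split=> // m mn; rewrite -ee' //; exact: ev.
  have [w wP] := bN e; have [s ws Es] := EIunb w.
  by exists s; split=> // m _; apply: lt_trans ws; exact: wP.
(* The stage [w] is a limit of an [N]-sequence of common closure points, so [a w] is cofinal in
   it. *)
have [w [ew wle]] : exists w, is_strict_sup (range e) w.
  apply: strict_sup_exists => //; have [w wP] := bN e.
  by exists w => _ [n _ <-]; exact: wP.
have [amono aw acof] : cofinal_in (a w) w.
  apply: aP; exists e; split=> [n m|n|t /wle[_ [n _ <-]]]; last by exists n.
    by rewrite le_eqVlt => /orP[/eqP->//|/(proj2 (eP m))/ltW].
  by apply: ew; exists n.
have candle n i k : i <= k -> cand g k w n <= cand g i w n.
  move=> ik; have [Ep pw _] := EP g k (a w n); have [_ _] := EP g i (a w n).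
  by apply=> // l li; apply: Ep; exact: lt_le_trans li ik.
have /choice[st stP] : forall n, exists i, forall k, i <= k -> cand g k w n = cand g i w n.
  move=> n; have [_ [i _ <-] ile] := ordinal_least wfW
    (ex_intro (range (fun i => cand g i w n)) _ (imageT _ i0)).
  exists i => k ik; apply/eqP; rewrite eq_le candle //=.
  by apply: ile; exists k.
have [i iP] := bNI st.
(* Any [j] above [i] serves: the candidate values at [i] and [j] coincide, and those at [j] are
   closure points of [g i]. *)
have [j jP] := bNI (fun=> i).
have ij : i < j by exact: (jP n0).
apply: (gP i w); split=> [n m nm|n|n].
- have [Ep pw _] := EP g i (a w n); have [_ _] := EP g i (a w m).
  by apply=> //; apply: le_trans pw _; exact: amono.
- have sti : st n <= i by exact/ltW/iP.
  rewrite (stP n i) // -(stP n j); last exact: le_trans (ltW ij).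
  by have [Ep _ _] := EP g j (a w n); exact: Ep.
(* A common closure point [e k'] lies strictly between [a w n] and [w]; once [a w m] passes it, so
   does the candidate value. *)
- have /wle[_ [k _ <-] ank] := aw n.
  have [k' kk'] := nomaxN k.
  have [m em] : exists m, e k' <= a w m by apply: acof; apply: ew; exists k'.
  exists m; have [_ pw _] := EP g i (a w n); have [_ _] := EP g i (a w m).
  move=> /(_ (e k') _ em) lem; apply: (le_lt_trans (le_trans pw ank)).
  apply: lt_le_trans (proj2 (eP k') k kk') (lem _).
  by move=> l _; exact: (proj1 (eP k')).
Qed.

End ClubGuessing.

(** * Traces of a covering matrix *)

Section EventualInclusion.
Context dT (T : orderType dT) (Y : Type).
Implicit Types F G H : T -> set Y.

Definition eventually_sub F G : Prop :=
  exists i, forall j, i <= j -> F j `<=` G j.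

Lemma eventually_sub_trans G F H :
  eventually_sub F G -> eventually_sub G H -> eventually_sub F H.
Proof.
move=> [i FG] [k GH]; exists (Order.max i k) => j.
by rewrite ge_max => /andP[/FG + /GH]; exact: subset_trans.
Qed.

End EventualInclusion.

Section Traces.
Context dT (T : orderType dT) dL (L : orderType dL).
Implicit Types (D : T -> L -> set L) (x : set L).

Definition trace D x (b : L) (j : T) : set L := D j b `&` x.

Lemma covering_sub_lt D i b : covering_matrix D -> D i b `<=` [set a | a < b].
Proof. by case=> _ <- _ a Da; exists i. Qed.

Lemma trace_le (t0 : T) D x b g : covering_matrix D -> transitive_matrix D ->
  b <= g -> eventually_sub (trace D x b) (trace D x g).
Proof.
move=> [Dmono Dcup _] trD; rewrite le_eqVlt => /orP[/eqP->|bg].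
  by exists t0 => j _ a.
have [i _ Dib] : (\bigcup_i D i g) b by rewrite Dcup.
exists i => j ij; apply: setSI; apply: trD => //; exact: Dmono Dib.
Qed.

(** [N], [I] and [R] stand for kappa^+, kappa^{++} and kappa^{+3}; they enter through
    well-foundedness and bounding properties. *)
Lemma trace_stabilizes dR (R : orderType dR) dI (I : orderType dI)
    dN (N : orderType dN) (t0 : T) (l0 : L) (r0 : R) (i0 : I) (n0 : N) D x :
  is_ordinal L -> is_ordinal R -> is_ordinal I -> is_ordinal N ->
  bounded_families [set: nat] R ->
  (forall u : R, bounded_families [set t | t <= u] R) ->
  bounded_families [set: N] R -> bounded_families [set: I] R ->
  bounded_families [set: N] I ->
  bounded_families [set: T] N -> bounded_families x N ->
  bounded_families [set: R] L -> bounded_families [set: I] L ->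
  bounded_families [set: N] L ->
  covering_matrix D -> transitive_matrix D -> uniform_matrix D ->
  exists b, forall g, b <= g -> eventually_sub (trace D x g) (trace D x b).
Proof.
move=> wfL wfR wfI wfN bnatR bsegR bNR bIR bNI bTN bxN bRL bIL bNL covD trD unifD.
pose F := trace D x.
have Fle b g : b <= g -> eventually_sub (F b) (F g) by exact: trace_le.
have nomaxN (n : N) : exists m, n < m.
  by have [m mP] := bTN (fun=> n); exists m; exact: (mP t0).
have nomaxR (r : R) : exists s, r < s.
  by have [m mP] := bIR (fun=> r); exists m; exact: (mP i0).
apply: contrapT => nonstab.
have grow b : exists2 g, b <= g & ~ eventually_sub (F g) (F b).
  apply: contrapT => ng; apply: nonstab; exists b => g bg.
  by apply: contrapT => nb; apply: ng; exists g.
have [c cP] := club_guessing r0 i0 n0 wfR wfN wfI nomaxN bnatR bsegR bNR bIR bNI.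
have /choice[S SP] : forall A : set L, exists s,
    (exists w, forall a, A a -> a < w) -> is_strict_sup A s.
  move=> A; have [/(strict_sup_exists wfL)[s sP]|nw] :=
    pselect (exists w, forall a, A a -> a < w); first by exists s.
  by exists l0.
(* The supremum of the earlier values; unlike [z], it is continuous, so it can land in a club. *)
pose sg (z : R -> L) s := S (z @` [set t | t < s]).
have sgP z s : is_strict_sup (z @` [set t | t < s]) (sg z s).
  by apply: SP; have [w wP] := bRL z; exists w => _ [t _ <-]; exact: wP.
have sg_loc z z' s s' : (forall t, t < s -> z t = z' t) -> s' <= s ->
    sg z s' = sg z' s'.
  move=> zz' ss'; congr S; apply: eq_imagel => t /= ts; apply: zz'.
  exact: lt_le_trans ts ss'.
pose G z w i n j := [set y | exists2 k, k <= n & F (sg z (c w i k)) j y].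
(* The clauses make [z] increasing, force a new trace at each stage, and put [F (z s)] eventually
   above every union [G] along a segment already visited, provided that union has an upper bound at
   all. *)
have [z zP] : exists z, forall s, [/\ sg z s <= z s,
    ~ eventually_sub (F (z s)) (F (sg z s)) &
    forall w i n, (forall k, k <= n -> c w i k <= s) ->
      (exists b, eventually_sub (G z w i n) (F b)) ->
      eventually_sub (G z w i n) (F (z s))].
  apply: (@wf_choice_recursion R L l0 (fun t s => t < s)
    (fun s z v => [/\ sg z s <= v, ~ eventually_sub (F v) (F (sg z s)) &
    forall w i n, (forall k, k <= n -> c w i k <= s) ->
      (exists b, eventually_sub (G z w i n) (F b)) ->
      eventually_sub (G z w i n) (F v)])) => // [s z z' v zz' [le grw dem]|s z _].
    rewrite -(sg_loc _ _ _ _ zz') //; split=> // w i n cs.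
    suff -> : G z' w i n = G z w i n by exact: dem.
    apply: funext => j; apply/seteqP; split=> y [k kn Fy]; exists k => //.
      by rewrite (sg_loc _ _ _ _ zz') // cs.
    by rewrite -(sg_loc _ _ _ _ zz') // cs.
  have /choice[bd bdP] : forall win : R * I * N, exists b,
      (exists b', eventually_sub (G z win.1.1 win.1.2 win.2) (F b')) ->
      eventually_sub (G z win.1.1 win.1.2 win.2) (F b).
    move=> [[w i] n]; have [[b bP]|nb] :=
      pselect (exists b', eventually_sub (G z w i n) (F b')).
      by exists b.
    by exists l0.
  (* The chosen bounds [bd] are dominated by one point, first over [N], then over [I], then over
     [R]. *)
  have /choice[bd2 bd2P] : forall wi : R * I, exists b, forall n, bd (wi, n) < b.
    by move=> wi; have [b bP] := bNL (fun n => bd (wi, n)); exists b => n; exact: bP.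
  have /choice[bd1 bd1P] : forall w : R, exists b, forall i, bd2 (w, i) < b.
    by move=> w; have [b bP] := bIL (fun i => bd2 (w, i)); exists b => n; exact: bP.
  have [b bP] := bRL bd1.
  have [g bg gP] := grow (Order.max b (sg z s)).
  move: bg; rewrite ge_max => /andP[bg sgg].
  exists g; split=> // [Fg|w i n _ ex].
    apply: gP; apply: eventually_sub_trans Fg _; apply: Fle.
    by rewrite le_max lexx orbT.
  apply: eventually_sub_trans (bdP (w, i, n) ex) _; apply: Fle.
  apply: le_trans bg; apply: ltW; apply: lt_trans (bd2P _ _) _.
  by apply: lt_trans (bd1P _ _) _; exact: bP.
have z_sg t s : t < s -> z t < sg z s.
  by move=> ts; have [+ _] := sgP z s; apply; exists t.
have sg_mono t s : t < s -> sg z t < sg z s.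
  by move=> /z_sg; apply: le_lt_trans; have [] := zP t.
have sg_below s v : v < sg z s -> exists2 t, t < s & v <= z t.
  by move=> vs; have [_ /(_ v vs)[_ [t ts <-] vt]] := sgP z s; exists t.
have [de [zde dele]] : exists de, is_strict_sup (range z) de.
  apply: strict_sup_exists => //; have [w wP] := bRL z.
  by exists w => _ [n _ <-]; exact: wP.
have sgde s : sg z s < de.
  by have [le _ _] := zP s; apply: le_lt_trans le _; apply: zde; exists s.
have delim : is_limit de.
  split=> [|a /dele[_ [t _ <-] at_]]; first by exists (z r0); apply: zde; exists r0.
  have [s ts] := nomaxR t; have [s' ss'] := nomaxR s.
  by exists (sg z s) => //; apply: le_lt_trans at_ (z_sg _ _ ts).
(* Here [id] is an index in [T], not the identity function. *)
have [id [C [Csub Cunb Ccl] CD]] := unifD de delim.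
have /choice[h hP] : forall t, exists s, exists2 q, C q & sg z t <= q /\ q < sg z s.
  move=> t; have [q Cq [tq qde]] := Cunb _ (sgde t).
  have [_ [s _ <-] qs] := dele q qde.
  have [s' ss'] := nomaxR s; exists s', q => //; split=> //.
  exact: le_lt_trans qs (z_sg _ _ ss').
have ht t : t < h t.
  have [q _ [tq qh]] := hP t; rewrite ltNge; apply/negP => hle.
  have : sg z t < sg z t.
    apply: le_lt_trans tq _; apply: lt_le_trans qh _.
    by move: hle; rewrite le_eqVlt => /orP[/eqP->//|/sg_mono/ltW].
  by rewrite ltxx.
have [w [i [cmono ccl cgrow]]] := cP h.
(* At a closure point [s] of [h] that has predecessors, [sg z s] is a limit of [C], hence in
   [D id de], and transitivity applies. At the least [s] the trace is empty. *)
have Fde s j : closure_points h s -> id <= j -> F (sg z s) j `<=` F de j.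
  move=> scl idj; apply: setSI.
  have [[r rs]|smin] := pselect (exists r, r < s); last first.
    move=> a /(covering_sub_lt covD) /sg_below[t ts _].
    by case: smin; exists t.
  have Csg : C (sg z s).
    apply: Ccl; [exact: sgde| |].
      split=> [|a /sg_below[t ts at_]]; first by exists (sg z r); exact: sg_mono.
      by exists (sg z (h t)); [apply: le_lt_trans at_ (z_sg _ _ (ht t))|exact/sg_mono/scl].
    move=> a /sg_below[t ts at_].
    have [q Cq [tq qh]] := hP (h t); exists q => //; split.
      by apply: le_trans tq; apply: le_trans at_ _; exact/ltW/z_sg/ht.
    by apply: lt_trans qh _; exact/sg_mono/scl/scl.
  apply: trD; first exact: sgde.
  by have [Dmono _ _] := covD; exact: Dmono idj _ (CD _ Csg).
(* The same [id] works for all terms, so the whole union is bounded and the third clause of [zP]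
   becomes available. *)
have Gde n : eventually_sub (G z w i n) (F de).
  by exists id => j idj y [k _]; exact: Fde.
(* Each point of [x] at each index in [T] enters at a definite stage, if ever; bounding over [T] and
   then over [x] gives a stage past all of these. *)
have [n nP] : exists n, forall m j, G z w i m j `<=` G z w i n j.
  have /choice[fst fstP] : forall yj : L * T, exists n, forall m,
      G z w i m yj.2 yj.1 -> exists2 k, k <= n & F (sg z (c w i k)) yj.2 yj.1.
    move=> [y j]; have [[m [k km Fk]]|nm] := pselect (exists m, G z w i m j y).
      by exists k => _ _; exists k.
    by exists n0 => m Gm; case: nm; exists m.
  have /choice[fst1 fst1P] : forall y, exists n, forall j, fst (y, j) < n.
    by move=> y; have [n nP] := bTN (fun j => fst (y, j)); exists n => j; exact: nP.
  have [n nP] := bxN fst1; exists n => m j y Gm.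
  have xy : x y by case: Gm => k _ [].
  have [k kn Fk] := fstP (y, j) m Gm; exists k => //.
  apply: le_trans kn (ltW _); apply: lt_trans (fst1P y j) _; exact: nP.
(* The eventual inclusions run from [F (z (c w i m2))] through [F (sg z (c w i m3))], [G z w i n]
   and [F (z (c w i m1))] to [F (sg z (c w i m2))], against growth at [c w i m2]. *)
have [m1 cm1] := cgrow n.
have [m2 cm2] := cgrow m1.
have [m3 cm3] := cgrow m2.
have [_ _ dem] := zP (c w i m1).
have [_ ngrow _] := zP (c w i m2).
apply: ngrow; apply: eventually_sub_trans (Fle _ _ (ltW (z_sg _ _ cm3))) _.
apply: (@eventually_sub_trans _ _ _ (G z w i n)).
  by exists t0 => j _ y Fy; apply: (nP m3); exists m3.
apply: eventually_sub_trans (dem w i n _ (ex_intro _ de (Gde n))) _.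
  by move=> k kn; apply: le_trans (ltW cm1); exact: cmono.
exact/Fle/ltW/z_sg.
Qed.

End Traces.

(** * Initial segments and successor cardinals *)

(** A subtype, so that cardinals found below [mu] can serve as ordered index types. *)
Definition segment d (W : orderType d) (b : W) : Type :=
  {a : W | a \in [set c | c < b]}.

HB.instance Definition _ d (W : orderType d) (b : W) := SubChoice.on (segment b).
HB.instance Definition _ d (W : orderType d) (b : W) :=
  [SubChoice_isSubOrder of segment b by <: with d].

Lemma segment_ordinal d (W : orderType d) (b : W) :
  is_ordinal W -> is_ordinal (segment b).
Proof.
move=> wfW s; move: {2}(val s) (erefl (val s)) => a.
elim/(well_founded_ind wfW): a s => a IH s sE.
by constructor=> t ts; apply: (IH (val t)) => //; rewrite -sE.
Qed.

Lemma card_segment d (W : orderType d) (b : W) :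
  [set: segment b] #= [set a | a < b].
Proof. exact: (card_setT [set a | a < b]). Qed.

Lemma card_le_segment d (W : orderType d) (b : W) U (B : set U) :
  ([set a | a < b] #<= B) = ([set: segment b] #<= B).
Proof. exact/esym/card_le_eql/card_segment. Qed.

Lemma bounded_families_segment X (A : set X) d (W : orderType d) (b : W)
    U (B : set U) :
  infinite_set B -> B `*` B #<= B ->
  ~ ([set: segment b] #<= B) -> (forall a, a < b -> [set c | c < a] #<= B) ->
  A #<= B -> bounded_families A (segment b).
Proof.
move=> Binf sqB bB segB; apply: regular_bounded_families Binf sqB _ bB => w.
have wb : val w < b by have := valP w; rewrite inE.
apply: card_le_trans (segB _ wb).
by apply: (card_leI (f := val)) => // u v _ _ /val_inj.
Qed.

(* A cardinal above its cofinality is a limit cardinal. *)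
Lemma next_cardinal dM (M : orderType dM) dT (T : orderType dT)
    dB (B : orderType dB) :
  is_cardinal M -> is_cofinality T M -> is_ordinal B ->
  infinite_set [set: B] -> [set: T] #<= [set: B] -> ~ ([set: M] #<= [set: B]) ->
  exists b : M, [/\ ~ ([set: segment b] #<= [set: B]),
    forall a, a < b -> [set c | c < a] #<= [set: B],
    ~ ([set: M] #<= [set: segment b]),
    [set: B] #<= [set: segment b] &
    infinite_set [set: segment b]].
Proof.
move=> [wfM cardM] [_ [A cofA AT] _] wfB Binf TB MB.
have [b bB bmin] : exists2 b : M, ~ ([set c | c < b] #<= [set: B]) &
    forall a, ~ ([set c | c < a] #<= [set: B]) -> b <= a.
  (* If every proper segment embedded in [B], regularity would bound the cofinal set [A], whose size
     is at most that of [B]. *)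
  apply: ordinal_least => //; apply: contrapT => nb.
  have segB (w : M) : [set c | c < w] #<= [set: B].
    by apply: contrapT => nw; apply: nb; exists w.
  have AB : A #<= [set: B] by rewrite (card_le_eql AT).
  have [w wP] := regular_bounded_families Binf (ordinal_square wfB Binf) segB MB AB id.
  by have [y Ay] := cofA w; rewrite leNgt wP.
have Bb : [set: B] #<= [set: segment b].
  by apply: (ordinal_card_total wfB); rewrite -card_le_segment.
exists b; split=> //.
- by rewrite -card_le_segment.
- by move=> a ab; apply: contrapT => /bmin; rewrite leNgt ab.
- have := card_ltNge (cardM b); rewrite (card_le_eqr (card_esym (card_segment b))).
  by [].
- by move=> fin; apply: Binf; exact: card_le_finite Bb fin.
Qed.

(** Regularity of mu^+: minimality of [L] gives its proper segments size at most that of [M]. *)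
Lemma successor_bounded_families X (A : set X) dL (L : orderType dL)
    dM (M : orderType dM) :
  is_infinite_cardinal M -> is_successor_cardinal L M ->
  A #<= [set: M] -> bounded_families A L.
Proof.
move=> [[wfM _] Minf] [[wfL cardL] ML minL] AM.
apply: (regular_bounded_families Minf (ordinal_square wfM Minf) _ _ AM).
  move=> w; apply: contrapT => nw; apply: (card_ltNge (cardL w)).
  by apply: minL; apply: card_ltI => //; exact: (ordinal_card_total wfM).
exact: card_ltNge.
Qed.

Lemma card_lt_setU dK (K : orderType dK) X (x y : set X) :
  is_infinite_cardinal K -> x #< [set: K] -> y #< [set: K] ->
  x `|` y #< [set: K].
Proof.
move=> [[wfK cardK] Kinf] xK yK.
have below (z : set X) : z #< [set: K] -> exists k : K, z #<= [set c | c < k].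
  move=> /card_ltNge zK; apply: contrapT => nk; apply: zK.
  apply: (card_le_small_segments wfK) => [a b _ _ /eqP|b _ zb].
    by rewrite neq_lt => /orP[]; [left|right].
  by apply: nk; exists b; apply: card_le_trans zb _; apply: subset_card_le => a [].
have [k1 xk1] := below _ xK; have [k2 yk2] := below _ yK.
pose k := Order.max k1 k2.
have xk : x #<= [set c | c < k].
  apply: card_le_trans xk1 _; apply: subset_card_le => c /=.
  by rewrite lt_max => ->.
have yk : y #<= [set c | c < k].
  apply: card_le_trans yk2 _; apply: subset_card_le => c /=.
  by rewrite lt_max => ->; rewrite orbT.
have [kfin|kinf] := pselect (finite_set [set c | c < k]).
  have fin : finite_set (x `|` y).
    by rewrite finite_setU; split; apply: card_le_finite kfin.
  have nfin : ~ ([set: K] #<= x `|` y).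
    by move=> le; apply: Kinf; exact: card_le_finite fin.
  apply: card_ltI nfin; apply: card_le_trans (finite_set_countable fin) _.
  exact/infiniteP.
have le := card_setU_le kinf (ordinal_square_lt wfK kinf) xk yk.
apply: card_ltI; first exact: card_le_trans le (card_lt_le (cardK k)).
by move=> Kle; apply: (card_ltNge (cardK k)); exact: card_le_trans le.
Qed.

(** * From stabilization to the covering property *)

Lemma le_PkappaE (K X : Type) (x y : Pkappa K X) :
  (x <= y) = (val x `<=` val y) :> Prop.
Proof. by rewrite -subsetEset. Qed.

Lemma Pkappa_card (K X : Type) (x : Pkappa K X) : val x #< [set: K].
Proof. by have := valP x; rewrite inE. Qed.

Lemma cofinal_Pkappa (K X : Type) (G : set (Pkappa K X)) (z : set X) :
  cofinal G -> z #< [set: K] -> exists2 y, G y & z `<=` val y.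
Proof.
move=> cofG zK; have [y Gy] := cofG (exist _ z (mem_set zK)).
by rewrite le_PkappaE => zy; exists y.
Qed.

Lemma traces_stabilize_CP dK (K : orderType dK) dT (T : orderType dT)
    dL (L : orderType dL) (D : T -> L -> set L) :
  is_infinite_cardinal K -> is_ordinal T -> [set: T] #< [set: K] ->
  bounded_families [set: T] L -> covering_matrix D ->
  (~ exists c : pairs (Pkappa K L) -> T, subadditive c /\ strongly_unbounded c) ->
  (forall x : Pkappa K L, exists b, (forall a, val x a -> a < b) /\
     forall g, b <= g ->
       eventually_sub (trace D (val x) g) (trace D (val x) b) /\
       eventually_sub (trace D (val x) b) (trace D (val x) g)) ->
  CP D.
Proof.
move=> Kcard wfT TK bTL [Dmono Dcup _] nocol /choice[b bP].
pose agree (x y : Pkappa K L) i := forall j, i <= j -> forall a, val x a ->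
  (D j (b x) a <-> D j (b y) a).
have agreeW x y i k : i <= k -> agree x y i -> agree x y k.
  by move=> ik xy j kj; apply: xy; exact: le_trans kj.
(* Both traces are compared with those at the larger of [b x] and [b y]. *)
have agree_ex x y : val x `<=` val y -> exists i, agree x y i.
  move=> xy.
  pose g := Order.max (b x) (b y).
  have [_ /(_ g)[|[i1 gx] [i2 xg]]] := bP x; first by rewrite le_max lexx.
  have [_ /(_ g)[|[i3 gy] [i4 yg]]] := bP y; first by rewrite le_max lexx orbT.
  exists (Order.max (Order.max i1 i2) (Order.max i3 i4)) => j.
  rewrite !ge_max => /andP[/andP[j1 j2] /andP[j3 j4]] a xa.
  have ya := xy _ xa.
  split=> Da.
    by have [Dg _] := xg j j2 a (conj Da xa); have [] := gy j j3 a (conj Dg ya).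
  by have [Dg _] := yg j j4 a (conj Da ya); have [] := gx j j1 a (conj Dg xa).
have /choice[l lP] : forall p : pairs (Pkappa K L), exists i,
    agree (val p).1 (val p).2 i /\ forall k, agree (val p).1 (val p).2 k -> i <= k.
  move=> [[x y] /= xy].
  have [i ag ile] : exists2 i, agree x y i & forall k, agree x y k -> i <= k.
    apply: ordinal_least => //; apply: agree_ex.
    by have := ltW xy; rewrite le_PkappaE.
  by exists i.
(* Agreement between [v] and [w] restricts to the points of [u], where it converts agreement of [u]
   with [v] into agreement of [u] with [w], and back. *)
have subl : subadditive l.
  move=> u v w uv vw uw.
  have [auv luv] := lP (mkpair uv); have [avw lvw] := lP (mkpair vw).
  have [auw luw] := lP (mkpair uw); rewrite /= in auv luv avw lvw auw luw.
  have /= suv : val u `<=` val v by have := ltW uv; rewrite le_PkappaE.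
  split.
    apply: luw => j; rewrite ge_max => /andP[j1 j2] a ua.
    have := auv j j1 a ua; have := avw j j2 a (suv _ ua); tauto.
  apply: luv => j; rewrite ge_max => /andP[j1 j2] a ua.
  have := auw j j1 a ua; have := avw j j2 a (suv _ ua); tauto.
(* Failure of strong unboundedness bounds [l] on a cofinal [G]; equal members are treated apart, as
   pairs are strict. *)
have [G [cofG [i0 i0P]]] : exists G : set (Pkappa K L), cofinal G /\
    exists i0, forall x y, G x -> G y -> val x `<=` val y -> agree x y i0.
  apply: contrapT => nG; apply: nocol; exists l; split=> // G cofG i.
  apply: contrapT => ni; apply: nG; exists G; split=> //; exists i => x y Gx Gy xy.
  have [->|xney] := eqVneq x y; first by [].
  have lxy : x < y by rewrite lt_neqAle xney /=; move: xy; rewrite -le_PkappaE.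
  apply: (agreeW _ _ (l (mkpair lxy))); last by have [] := lP (mkpair lxy).
  rewrite leNgt; apply/negP => li; apply: ni; exists (l (mkpair lxy)); last exact: ltW.
  by exists (mkpair lxy).
have [[wfK _] Kinf] := Kcard.
have /choice[X XP] : forall a : L, exists x, G x /\ val x a.
  move=> a; have aK : [set a] #< [set: K].
    apply: card_ltI => [|Ka]; last first.
      by apply: Kinf; apply: card_le_finite Ka (finite_set1 a).
    have [k _] := infinite_setN0 Kinf.
    by apply: (card_leI (f := fun=> k)) => // x y /= -> ->.
  by have [y Gy ay] := cofinal_Pkappa cofG aK; exists y; split=> //; exact: ay.
(* The maximum with [i0] puts [f a] where nested members of [G] agree. *)
have /choice[f fP] : forall a, exists j, i0 <= j /\ D j (b (X a)) a.
  move=> a; have [_ Xa] := XP a; have [ab _] := bP (X a).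
  have [j _ Dj] : (\bigcup_i D i (b (X a))) a by rewrite Dcup; exact: ab.
  exists (Order.max i0 j); split; first by rewrite le_max lexx.
  by apply: Dmono Dj; rewrite le_max lexx orbT.
(* Pigeonhole: bounds for all the sets [[set a | f a <= j]] would have a common bound in [L]. *)
have [j cofA] : exists j, cofinal [set a | f a <= j].
  apply: contrapT => nj.
  have /choice[u uP] : forall j, exists u, forall a, f a <= j -> a < u.
    move=> j; apply: contrapT => nu; apply: nj; exists j => v.
    apply: contrapT => ny; apply: nu; exists v => a fa.
    by rewrite ltNge; apply/negP => va; apply: ny; exists a.
  have [v vP] := bTL u.
  have := uP (f v) v (lexx _); rewrite ltNge => /negP; apply.
  exact/ltW/vP.
exists [set a | f a <= j] => // Z ZA ZT.
have ZK : Z #< [set: K].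
  apply: card_ltI; first by rewrite (card_le_eql ZT); exact: card_lt_le.
  by rewrite (card_le_eqr ZT); exact: card_ltNge.
have [y Gy Zy] := cofinal_Pkappa cofG ZK.
exists (b y), j => a Za.
have [Gx xa] := XP a; have [if_ Da] := fP a.
(* [X a] and [y] may be incomparable, so membership of [a] passes from [b (X a)] to [b y] through a
   member [z] of [G] containing both. *)
have xyK := card_lt_setU Kcard (Pkappa_card (X a)) (Pkappa_card y).
have [z Gz] := cofinal_Pkappa cofG xyK; rewrite subUset => -[xz yz].
have ij : i0 <= j by apply: le_trans if_ (ZA _ Za).
have Dj : D j (b (X a)) a by apply: Dmono Da; exact: ZA.
apply/(i0P y z Gy Gz yz j ij a (Zy _ Za)).
by apply/(i0P (X a) z Gx Gz xz j ij a xa).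
Qed.

Theorem theorem4p4
    (dK : Order.disp_t) (kappa : orderType dK)
    (dM : Order.disp_t) (mu : orderType dM)
    (dT : Order.disp_t) (cf_mu : orderType dT)
    (dL : Order.disp_t) (mu_plus : orderType dL)
    (kappa_card : is_infinite_cardinal kappa)
    (mu_card : is_infinite_cardinal mu)
    (kappa_lt_mu : [set: kappa] #< [set: mu])
    (cf_muE : is_cofinality cf_mu mu)
    (mu_plusE : is_successor_cardinal mu_plus mu)
    (cf_mu_lt_kappa : [set: cf_mu] #< [set: kappa])
    (no_coloring : ~ exists c : pairs (Pkappa kappa mu_plus) -> cf_mu,
        subadditive c /\ strongly_unbounded c) :
  forall D : cf_mu -> mu_plus -> set mu_plus,
    covering_matrix D -> transitive_matrix D -> uniform_matrix D -> CP D.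
Proof.
move=> D covD trD unifD.
have [[wfK _] Kinf] := kappa_card; have [[wfM cardM] Minf] := mu_card.
have [[wfT _] [A cofA AT] _] := cf_muE; have [[wfL _] _ _] := mu_plusE.
have [t0 _] : [set: cf_mu] !=set0.
  have [m _] := infinite_setN0 Minf; have [a Aa _] := cofA m.
  apply: contrapT => T0; suff : A = set0 by move=> A0; rewrite A0 in Aa.
  move: AT; rewrite (_ : [set: cf_mu] = set0) ?card_eq0; first by move/eqP.
  by apply/seteqP; split=> // t _; apply: T0; exists t.
have TK := card_lt_le cf_mu_lt_kappa.
have KM := card_lt_le kappa_lt_mu.
(* Three successor steps inside [mu]: [n], [i] and [r] represent kappa^+, kappa^{++} and
   kappa^{+3}. *)
have [n [nK segn Mn Kn ninf]] :=
  next_cardinal (conj wfM cardM) cf_muE wfK Kinf TK (card_ltNge kappa_lt_mu).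
have wfn := segment_ordinal (b := n) wfM; have Tn := card_le_trans TK Kn.
have [i [ni segi Mi Ni iinf]] :=
  next_cardinal (conj wfM cardM) cf_muE wfn ninf Tn Mn.
have wfi := segment_ordinal (b := i) wfM; have Ti := card_le_trans Tn Ni.
have [r [ir segr Mr Ir rinf]] :=
  next_cardinal (conj wfM cardM) cf_muE wfi iinf Ti Mi.
have wfr := segment_ordinal (b := r) wfM.
have [n0 _] := infinite_setN0 ninf; have [i1 _] := infinite_setN0 iinf.
have [r0 _] := infinite_setN0 rinf.
have bN X (B : set X) : B #<= [set: kappa] -> bounded_families B (segment n).
  exact: bounded_families_segment Kinf (ordinal_square wfK Kinf) nK segn.
have bI X (B : set X) : B #<= [set: segment n] -> bounded_families B (segment i).
  exact: bounded_families_segment ninf (ordinal_square wfn ninf) ni segi.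
have bR X (B : set X) : B #<= [set: segment i] -> bounded_families B (segment r).
  exact: bounded_families_segment iinf (ordinal_square wfi iinf) ir segr.
have bL X (B : set X) : B #<= [set: mu] -> bounded_families B mu_plus.
  exact: successor_bounded_families mu_card mu_plusE.
have segM (b : mu) : [set: segment b] #<= [set: mu].
  by rewrite -card_le_segment; exact: card_leT.
have natr : [set: nat] #<= [set: segment i] by exact/infiniteP.
have bRseg (u : segment r) : bounded_families [set t | t <= u] (segment r).
  have [v vP] := bR _ _ natr (fun=> u).
  have uv : u < v by exact: (vP 0%N).
  apply: bR; have vr : val v < r by have := valP v; rewrite inE.
  apply: card_le_trans (segr _ vr).
  by apply: (card_leI (f := val)) => [t /= tu|t t' _ _ /val_inj //]; exact: le_lt_trans uv.
have xK (x : Pkappa kappa mu_plus) := card_lt_le (Pkappa_card x).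
apply: (traces_stabilize_CP kappa_card) => // [|x].
  by apply: bL; exact: card_le_trans KM.
have [b' b'P] := bL _ (val x) (card_le_trans (xK x) KM) id.
have [b bP] := trace_stabilizes t0 b' r0 i1 n0 wfL wfr wfi wfn
  (bR _ _ natr) bRseg (bR _ _ Ni) (bR _ _ (card_lexx _)) (bI _ _ (card_lexx _))
  (bN _ _ TK) (bN _ _ (xK x)) (bL _ _ (segM r)) (bL _ _ (segM i)) (bL _ _ (segM n))
  covD trD unifD.
(* The maximum with [b'] puts all of [x] below the point, while stabilization persists above [b]. *)
exists (Order.max b b'); split=> [a xa|g].
  by rewrite lt_max (b'P a xa) orbT.
move=> mg; split; last exact: trace_le.
move: (mg); rewrite ge_max => /andP[bg _].
apply: eventually_sub_trans (bP g bg) _; apply: trace_le => //.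
by rewrite le_max lexx.
Qed.
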